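(* Let $D$ be an integral domain with the $t$-finite character. Then $D$ is stable if and only if each nonzero ideal $I$ of $D$ is faithfully flat in $(I:I)$.
   Context: $D$ is an integral domain with quotient field $K$. ''Ideal of $D$'' means fractional ideal: a $D$-submodule $I$ of $K$ with $dI\subseteq D$ for some nonzero $d\in D$. For $D$-submodules $A,B$ of $K$, $(A:B)=\{x\in K\mid xB\subseteq A\}$; for a nonzero ideal $I$, $(I:I)$ is a ring between $D$ and $K$ (the endomorphism ring of $I$), and $I$ is an ideal of it. ''$I$ is faithfully flat (projective) in $(I:I)$'' means that $I$ is a faithfully flat (projective) $(I:I)$-module. A nonzero ideal $I$ is stable if $I$ is projective in $(I:I)$, and $D$ is stable if each nonzero ideal of $D$ is stable. For a nonzero ideal $J$, $J_v=(D:(D:J))$, and for a nonzero ideal $I$, $I_t=\bigcup J_v$, where the union is over all nonzero finitely generated $D$-submodules $J$ of $K$ with $J\subseteq I$. A nonzero ideal $I$ is a $t$-ideal if $I=I_t$. A $t$-maximal ideal is an ideal maximal in the set of proper $t$-ideals of $D$ (those properly contained in $D$). $D$ has the $t$-finite character if each proper $t$-ideal (nonzero, properly contained in $D$) is contained in only finitely many $t$-maximal ideals. *)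

(* Defs.v *)
From HB Require Import structures.
From mathcomp Require Import all_boot all_order all_algebra.
From mathcomp Require Import boolp classical_sets cardinality.

Set Implicit Arguments.
Unset Strict Implicit.
Unset Printing Implicit Defensive.

Import GRing.Theory.
Local Open Scope ring_scope.
Local Open Scope quotient_scope.
Local Open Scope classical_set_scope.

Local Notation bilinear_map b := (bilinear_for *:%R *:%R b).

(* Tensor product over a commutative ring: formal sums of pairs, two of which
   are identified when every bilinear map gives them the same value. *)
Section Tensor.
Variables (R : comNzRingType) (M N : lmodType R).
Implicit Types s t : seq (M * N).

Definition tens_eval (P : lmodType R) (b : M -> N -> P) s : P :=
  \sum_(p <- s) b p.1 p.2.

Definition tens_eq : rel (seq (M * N)) := fun s t =>
  `[< forall (P : lmodType R) (b : M -> N -> P),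
        bilinear_map b -> tens_eval b s = tens_eval b t >].

Lemma tens_eqP s t :
  reflect (forall (P : lmodType R) (b : M -> N -> P),
             bilinear_map b -> tens_eval b s = tens_eval b t) (tens_eq s t).
Proof. exact: asboolP. Qed.

Fact tens_eq_refl : reflexive tens_eq.
Proof. by move=> s; apply/tens_eqP. Qed.

Fact tens_eq_sym : symmetric tens_eq.
Proof.
by move=> s t; apply/tens_eqP/tens_eqP => st P b /st.
Qed.

Fact tens_eq_trans : transitive tens_eq.
Proof.
by move=> t s u /tens_eqP st /tens_eqP tu; apply/tens_eqP => P b bb;
   rewrite st ?tu.
Qed.

Canonical tens_equiv := EquivRel tens_eq tens_eq_refl tens_eq_sym tens_eq_trans.

Definition tensor : Type := {eq_quot tens_equiv}.
HB.instance Definition _ : EqQuotient _ tens_equiv tensor := EqQuotient.on tensor.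
HB.instance Definition _ := Choice.on tensor.

Implicit Types x y : tensor.

Definition tens_lift (P : lmodType R) (b : M -> N -> P) x : P :=
  tens_eval b (repr x).

Lemma tens_lift_pi (P : lmodType R) (b : M -> N -> P) s :
  bilinear_map b -> tens_lift b (\pi_tensor s) = tens_eval b s.
Proof.
move=> bb; apply: (elimT (tens_eqP _ _)) bb.
by apply/eqmodP; rewrite reprK.
Qed.

Lemma tens_ext x y :
  (forall (P : lmodType R) (b : M -> N -> P),
     bilinear_map b -> tens_lift b x = tens_lift b y) -> x = y.
Proof.
by move=> xy; rewrite -[x]reprK -[y]reprK; apply/eqmodP/tens_eqP.
Qed.

Definition tens_zero : tensor := \pi_tensor [::].
Definition tens_add x y : tensor := \pi_tensor (repr x ++ repr y).
Definition tens_scale (a : R) x : tensor :=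
  \pi_tensor [seq (a *: p.1, p.2) | p <- repr x].
Definition tens_opp x : tensor := tens_scale (-1) x.

Section Lift.
Variables (P : lmodType R) (b : M -> N -> P).
Hypothesis bb : bilinear_map b.

Lemma tens_lift0 : tens_lift b tens_zero = 0.
Proof. by rewrite tens_lift_pi // /tens_eval big_nil. Qed.

Lemma tens_liftD x y :
  tens_lift b (tens_add x y) = tens_lift b x + tens_lift b y.
Proof. by rewrite tens_lift_pi // /tens_eval big_cat. Qed.

Lemma tens_liftZ a x : tens_lift b (tens_scale a x) = a *: tens_lift b x.
Proof.
rewrite tens_lift_pi // /tens_lift /tens_eval big_map scaler_sumr.
apply: eq_bigr => p _ /=.
have b0 : b 0 p.2 = 0.
  by have := bb.1 p.2 (-1) 0 0; rewrite /= scaler0 addr0 scaleN1r addNr.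
by have := bb.1 p.2 a p.1 0; rewrite /= addr0 b0 addr0.
Qed.

Lemma tens_liftN x : tens_lift b (tens_opp x) = - tens_lift b x.
Proof. by rewrite tens_liftZ scaleN1r. Qed.

Definition tens_liftE := (tens_lift0, tens_liftD, tens_liftN, tens_liftZ).
End Lift.

Fact tens_addA : associative tens_add.
Proof. by move=> x y z; apply: tens_ext => P b bb; rewrite !tens_liftE ?addrA. Qed.
Fact tens_addC : commutative tens_add.
Proof. by move=> x y; apply: tens_ext => P b bb; rewrite !tens_liftE // addrC. Qed.
Fact tens_add0 : left_id tens_zero tens_add.
Proof. by move=> x; apply: tens_ext => P b bb; rewrite !tens_liftE ?add0r. Qed.
Fact tens_addN : left_inverse tens_zero tens_opp tens_add.
Proof. by move=> x; apply: tens_ext => P b bb; rewrite !tens_liftE ?addNr. Qed.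

HB.instance Definition _ :=
  GRing.isZmodule.Build tensor tens_addA tens_addC tens_add0 tens_addN.

Fact tens_scaleA a c x : tens_scale a (tens_scale c x) = tens_scale (a * c) x.
Proof. by apply: tens_ext => P b bb; rewrite !tens_liftE // scalerA. Qed.
Fact tens_scale1 : left_id 1 tens_scale.
Proof. by move=> x; apply: tens_ext => P b bb; rewrite !tens_liftE // scale1r. Qed.
Fact tens_scaleDr : right_distributive tens_scale +%R.
Proof.
by move=> a x y; apply: tens_ext => P b bb; rewrite !tens_liftE // scalerDr.
Qed.
Fact tens_scaleDl x : {morph tens_scale^~ x : a c / a + c}.
Proof.
by move=> a c; apply: tens_ext => P b bb; rewrite !tens_liftE // scalerDl.
Qed.

HB.instance Definition _ := GRing.Zmodule_isLmodule.Build R tensor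
  tens_scaleA tens_scale1 tens_scaleDr tens_scaleDl.

Definition tens (m : M) (n : N) : tensor := \pi_tensor [:: (m, n)].

Lemma tens_lift_tens (P : lmodType R) (b : M -> N -> P) m n :
  bilinear_map b -> tens_lift b (tens m n) = b m n.
Proof. by move=> bb; rewrite tens_lift_pi // /tens_eval big_seq1. Qed.

Lemma tens_bilinear : bilinear_map tens.
Proof.
split=> [n|m] a u v; apply: tens_ext => P b bb;
  rewrite !(tens_liftD, tens_liftZ, tens_lift_tens) //;
  [exact: bb.1 | exact: bb.2].
Qed.

Lemma tens_lift_linear (P : lmodType R) (b : M -> N -> P) :
  bilinear_map b -> linear (tens_lift b).
Proof. by move=> bb a x y; rewrite tens_liftD // tens_liftZ. Qed.

Lemma tensE x : x = \sum_(p <- repr x) tens p.1 p.2.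
Proof.
apply: tens_ext => P b bb; rewrite {1}/tens_lift /tens_eval.
elim: (repr x) => [|p s IHs]; first by rewrite !big_nil tens_lift0.
by rewrite !big_cons tens_liftD // tens_lift_tens // IHs.
Qed.

Theorem tens_universal (P : lmodType R) (b : M -> N -> P) :
  bilinear_map b ->
  exists2 h : {linear tensor -> P}, (forall m n, h (tens m n) = b m n) &
    forall g : {linear tensor -> P}, (forall m n, g (tens m n) = b m n) ->
      g =1 h.
Proof.
move=> bb.
pose hL := GRing.isLinear.Build R tensor P *:%R _ (tens_lift_linear bb).
pose h : {linear tensor -> P} := HB.pack (tens_lift b) hL.
exists h => [m n|g gE x]; first exact: tens_lift_tens.
rewrite [x]tensE !linear_sum; apply: eq_bigr => p _.
by rewrite /h /= tens_lift_tens.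
Qed.

End Tensor.

Section TensorMap.
Variables (R : comNzRingType) (M N N' : lmodType R) (g : {linear N -> N'}).

Definition tens_map : tensor M N -> tensor M N' :=
  tens_lift (fun m n => tens m (g n)).

Fact tens_map_bilinear : bilinear_map (fun (m : M) n => tens m (g n)).
Proof.
split=> [n|m] a u v /=; first exact: (tens_bilinear _ _).1.
by rewrite linearP; exact: (tens_bilinear _ _).2.
Qed.

Lemma tens_map_tens m n : tens_map (tens m n) = tens m (g n).
Proof. exact: tens_lift_tens tens_map_bilinear. Qed.

Fact tens_map_linear : linear tens_map.
Proof. exact: tens_lift_linear tens_map_bilinear. Qed.

HB.instance Definition _ := GRing.isLinear.Build R (tensor M N) (tensor M N')
  *:%R tens_map tens_map_linear.
End TensorMap.
Arguments tens_map {R} M {N N'} g.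

Definition exact_at (R : comNzRingType) (N1 N2 N3 : lmodType R)
    (f : {linear N1 -> N2}) (g : {linear N2 -> N3}) : Prop :=
  forall y, g y = 0 <-> exists x, f x = y.

(* M (x) - both preserves and reflects exactness; since f and g are arbitrary,
   this covers flatness as well as faithfulness. *)
Definition faithfully_flat (R : comNzRingType) (M : lmodType R) : Prop :=
  forall (N1 N2 N3 : lmodType R) (f : {linear N1 -> N2}) (g : {linear N2 -> N3}),
    exact_at f g <-> exact_at (tens_map M f) (tens_map M g).

Definition projective (R : comNzRingType) (P : lmodType R) : Prop :=
  forall (M N : lmodType R) (g : {linear M -> N}) (f : {linear P -> N}),
    (forall y, exists x, g x = y) ->
    exists h : {linear P -> M}, forall p, g (h p) = f p.

Section FractionalIdeals.
Variable D : idomainType.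
Local Notation K := {fraction D}.
Local Notation "x %:F" := (@FracField.tofrac D x).

Implicit Types A B I J M : set K.

Definition dom_set : set K := range (@FracField.tofrac D).

Definition is_submodule A : Prop :=
  [/\ A 0, (forall x y, A x -> A y -> A (x + y)) &
      (forall (d : D) x, A x -> A (d%:F * x))].

(* Fractional ideals; they need not be contained in dom_set. *)
Definition is_ideal I : Prop :=
  is_submodule I /\ exists2 d : D, d != 0 & forall x, I x -> dom_set (d%:F * x).

Definition nonzero I : Prop := exists2 x, I x & x != 0.

Definition colon A B : set K := [set x | forall b, B b -> A (x * b)].

Definition fin_gen J : Prop :=
  exists n (g : 'I_n -> K),
    J = [set x | exists c : 'I_n -> D, x = \sum_(i < n) (c i)%:F * g i].

Definition v_closure J : set K := colon dom_set (colon dom_set J).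

Definition t_closure I : set K :=
  [set x | exists J, [/\ is_submodule J, nonzero J, fin_gen J, J `<=` I
                       & v_closure J x]].

Definition t_ideal I : Prop := [/\ is_ideal I, nonzero I & I = t_closure I].

Definition proper_t_ideal I : Prop := t_ideal I /\ I `<` dom_set.

Definition t_maximal M : Prop :=
  proper_t_ideal M /\ forall J, proper_t_ideal J -> M `<=` J -> J = M.

Definition t_finite_character : Prop :=
  forall I, proper_t_ideal I -> finite_set [set M | t_maximal M /\ I `<=` M].

Structure fracIdeal := FracIdeal {
  ideal_set :> set K;
  ideal_setP : is_ideal ideal_set }.

End FractionalIdeals.

Section EndoRing.
Variables (D : idomainType) (I : fracIdeal D).
Local Notation K := {fraction D}.
Local Notation Iset := (ideal_set I).

Fact ideal0 : Iset 0.
Proof. by case: (ideal_setP I) => -[]. Qed.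
Fact idealD x y : Iset x -> Iset y -> Iset (x + y).
Proof. by case: (ideal_setP I) => -[_ + _] _; apply. Qed.
Fact idealN x : Iset x -> Iset (- x).
Proof.
case: (ideal_setP I) => -[_ _ IZ] _ /(IZ (-1)).
by rewrite rmorphN1 mulN1r.
Qed.

Definition endo_pred : {pred K} := fun x => `[< colon Iset Iset x >].

Lemma endoP x : reflect (colon Iset Iset x) (x \in endo_pred).
Proof. exact: asboolP. Qed.

Fact endo_subring_closed : subring_closed endo_pred.
Proof.
split=> [|x y /endoP Ix /endoP Iy|x y /endoP Ix /endoP Iy]; apply/endoP => b Ib.
- by rewrite mul1r.
- by rewrite mulrBl; apply/idealD/idealN; [exact: Ix | exact: Iy].
- by rewrite -mulrA; exact/Ix/Iy.
Qed.
HB.instance Definition _ :=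
  GRing.isSubringClosed.Build K endo_pred endo_subring_closed.

Record endo := Endo { endo_val :> K; endo_valP : endo_val \in endo_pred }.
HB.instance Definition _ := [isSub for endo_val].
HB.instance Definition _ := [Choice of endo by <:].
HB.instance Definition _ := [SubChoice_isSubComNzRing of endo by <:].

Definition ideal_pred : {pred K} := fun x => `[< Iset x >].

Lemma ideal_predP x : reflect (Iset x) (x \in ideal_pred).
Proof. exact: asboolP. Qed.

Fact ideal_zmod_closed : zmod_closed ideal_pred.
Proof.
split=> [|x y /ideal_predP Ix /ideal_predP Iy]; apply/ideal_predP.
  exact: ideal0.
exact/idealD/idealN.
Qed.
HB.instance Definition _ :=
  GRing.isZmodClosed.Build K ideal_pred ideal_zmod_closed.

Record ideal_mod :=
  IdealMod { ideal_val :> K; ideal_valP : ideal_val \in ideal_pred }.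
HB.instance Definition _ := [isSub for ideal_val].
HB.instance Definition _ := [Choice of ideal_mod by <:].
HB.instance Definition _ := [SubChoice_isSubZmodule of ideal_mod by <:].

Fact ideal_scale_subproof (a : endo) (x : ideal_mod) :
  endo_val a * ideal_val x \in ideal_pred.
Proof.
by apply/ideal_predP; apply: (elimT (endoP _) (endo_valP a));
   exact/ideal_predP/ideal_valP.
Qed.
Definition ideal_scale (a : endo) (x : ideal_mod) : ideal_mod :=
  IdealMod (ideal_scale_subproof a x).

Fact ideal_scaleA a c x :
  ideal_scale a (ideal_scale c x) = ideal_scale (a * c) x.
Proof. by apply: val_inj; rewrite /= mulrA. Qed.
Fact ideal_scale1 : left_id 1 ideal_scale.
Proof. by move=> x; apply: val_inj; rewrite /= mul1r. Qed.
Fact ideal_scaleDr : right_distributive ideal_scale +%R.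
Proof. by move=> a x y; apply: val_inj; rewrite /= mulrDr. Qed.
Fact ideal_scaleDl x : {morph ideal_scale^~ x : a c / a + c}.
Proof. by move=> a c; apply: val_inj; rewrite /= mulrDl. Qed.
HB.instance Definition _ := GRing.Zmodule_isLmodule.Build endo ideal_mod
  ideal_scaleA ideal_scale1 ideal_scaleDr ideal_scaleDl.

Definition stable_ideal : Prop := projective ideal_mod.
Definition faithfully_flat_in_endo : Prop := faithfully_flat ideal_mod.
End EndoRing.

Definition stable_domain (D : idomainType) : Prop :=
  forall I : fracIdeal D, nonzero I -> stable_ideal I.

(* Main.v *)
Require Import Defs.
From HB Require Import structures.
From mathcomp Require Import all_boot all_algebra ring.
From mathcomp Require Import boolp classical_sets cardinality.
From mathcomp Require freeg.

Set Implicit Arguments.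
Unset Strict Implicit.
Unset Printing Implicit Defensive.

Import GRing.Theory.
Local Open Scope ring_scope.
Local Open Scope classical_set_scope.

(** Write E = (I : I) for a nonzero fractional ideal I of D, K for the fraction
field.  Both directions go through invertibility of I in E, that is, through
the equation 1 = a_1 b_1 + ... + a_n b_n with a_i in I and b_i in (E : I).

Stable implies faithfully flat.  A splitting of the free cover of I gives a
dual basis; its coordinate functionals are multiplications by elements of
(E : I), and comparing coordinates of one nonzero element yields the equation
above ([projective_invertible]).  Conversely, that equation makes tensoring
with I an equivalence, with a_i and b_i providing explicit maps
N -> I (x) N -> N, so I is both faithfully flat and projective
([invertible_projective_faithfully_flat]).

Faithfully flat implies stable.  Let every nonzero ideal be faithfully flat
over its endomorphism ring.  Then I is locally principal over E: at a maximal
ideal N of E, faithfulness gives x in I outside N I, and for y in I the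
equational criterion applied to y . x - x . y = 0 gives t outside N with
t y in x E ([faithfully_flat_local_generator]).  Hence I is invertible as soon
as it is finitely generated over E ([fin_gen_invertible]), and finite generation
is what has to be extracted from the t-finite character.  Three facts do it.

- Every nonzero maximal ideal M of D is t-maximal.  Otherwise M contains a
  finitely generated J with (D : J) = D; such a J has (J : J) = D, so it is
  invertible in D with inverse D, that is J = D ([maximal_t_closed]).
  Therefore a nonzero element of D lies in finitely many maximal ideals
  ([finite_character]).
- Over one maximal ideal M of D, the ring E has at most two maximal ideals
  ([at_most_two_above]).  For p and q in K, the ideal D p + D q is invertible in
  its endomorphism ring, and writing out this fact in coordinates shows that,
  locally at M, one of p^2 in q (p, q), q^2 in p (p, q), q^2 in (p + q) (p, q)
  holds ([quadratic_relation]).  If E had three maximal ideals above M, elements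
  p, q and p + q that lie in exactly one of the three, and in different ones,
  would contradict all three relations.
- Choose x0 <> 0 in I and b <> 0 with b I in D, and put e = b x0.  At a maximal
  ideal of E that avoids e, the element x0 generates I.  The maximal ideals that
  contain e lie above finitely many maximal ideals of D, hence are finitely many.
  Adding one local generator for each of them to x0 gives a finite set that
  generates I locally everywhere, so generates I
  ([faithfully_flat_invertible]). *)

(** * Ideals of a subring *)

Section SetRings.
Variable K : comNzRingType.
Implicit Types A B N S : set K.

Definition subring_set B : Prop :=
  [/\ B 1, (forall x y, B x -> B y -> B (x - y)) &
      (forall x y, B x -> B y -> B (x * y))].

Definition module_over B S : Prop :=
  [/\ S 0, (forall x y, S x -> S y -> S (x + y)) &
      (forall b x, B b -> S x -> S (b * x))].

Definition ideal_of B N : Prop := module_over B N /\ N `<=` B.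

(** The last clause says that the quotient of B by N is a field, which for an
ideal is maximality stated on elements. *)
Definition maximal_in B N : Prop :=
  [/\ ideal_of B N, ~ N 1 & forall x, B x -> ~ N x -> exists2 b, B b & N (1 - b * x)].

Section Subring.
Variable B : set K.
Hypothesis rB : subring_set B.

Lemma subring1 : B 1. Proof. by case: rB. Qed.
Lemma subringB x y : B x -> B y -> B (x - y). Proof. by case: rB => _ + _; apply. Qed.
Lemma subringM x y : B x -> B y -> B (x * y). Proof. by case: rB => _ _; apply. Qed.
Lemma subring0 : B 0.
Proof. by rewrite -(subrr 1); apply: subringB; exact: subring1. Qed.
Lemma subringN x : B x -> B (- x).
Proof. by move=> Bx; rewrite -sub0r; apply: subringB => //; exact: subring0. Qed.
Lemma subringD x y : B x -> B y -> B (x + y).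
Proof. by move=> Bx By; rewrite -[y]opprK; apply/subringB/subringN. Qed.

Lemma module0 S : module_over B S -> S 0. Proof. by case. Qed.
Lemma moduleD S x y : module_over B S -> S x -> S y -> S (x + y).
Proof. by case=> _ + _; apply. Qed.
Lemma moduleM S b x : module_over B S -> B b -> S x -> S (b * x).
Proof. by case=> _ _; apply. Qed.
Lemma moduleN S x : module_over B S -> S x -> S (- x).
Proof.
by move=> mS Sx; rewrite -mulN1r; apply: moduleM => //; apply/subringN/subring1.
Qed.
Lemma moduleB S x y : module_over B S -> S x -> S y -> S (x - y).
Proof. by move=> mS Sx Sy; apply: moduleD => //; exact: moduleN. Qed.

(** Zorn's lemma is applied to the sets whose union with A is a proper ideal, so
that the empty chain causes no trouble. *)
Lemma exists_maximal A : ideal_of B A -> ~ A 1 -> exists2 N, maximal_in B N & A `<=` N.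
Proof.
move=> [mA AB] A1; pose P S := ideal_of B (A `|` S) /\ ~ (A `|` S) 1.
have [F FP Ftot|N [[iN N1] Nmax]] := @Zorn_bigcup _ P.
  have [->|/set0P [S0 FS0]] := eqVneq F set0.
    by rewrite bigcup_set0 /P setU0.
  have FE x : (A `|` \bigcup_(S in F) S) x <-> exists2 S, F S & (A `|` S) x.
    split=> [[Ax|[S FS Sx]]|[S FS [Ax|Sx]]]; [|by exists S => //; right|by left|].
      by exists S0 => //; left.
    by right; exists S.
  split; last by move/FE => [S /FP [_ SP1]].
  split; last by move=> x /FE [S /FP [[_ SB] _]]; exact: SB.
  split; first by left; exact: module0 mA.
    move=> x y /FE [S FS Sx] /FE [T FT Ty]; apply/FE.
    have [ST|TS] := Ftot _ _ FS FT.
      have [[mT _] _] := FP _ FT; exists T => //.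
      by apply: (moduleD mT) => //; case: Sx => [|/ST]; [left|right].
    have [[mS _] _] := FP _ FS; exists S => //.
    by apply: (moduleD mS) => //; case: Ty => [|/TS]; [left|right].
  move=> b x Bb /FE [S FS Sx]; apply/FE; exists S => //.
  by have [[mS _] _] := FP _ FS; exact: (moduleM mS).
exists (A `|` N); last by move=> x; left.
split=> // x Bx ANx; apply: contrapT => noinv.
(* A failure of invertibility of x modulo A + N makes A + N + B x proper. *)
pose M := [set z | exists2 b, B b & (A `|` N) (z - b * x)].
have NM : A `|` N `<=` M.
  by move=> z Nz; exists 0; rewrite ?mul0r ?subr0 //; exact: subring0.
have AM : A `|` M = M by rewrite setUidr // => z Az; apply: NM; left.
have [mAN ANB] := iN.
apply: (Nmax M).
  split; first by move=> z Nz; apply: NM; right.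
  move=> /(_ x) MN; apply: ANx; right; apply: MN.
  by exists 1; [exact: subring1 | rewrite mul1r subrr; exact: module0 mAN].
rewrite /P AM; split; last by case=> b Bb bx; apply: noinv; exists b.
split; last first.
  by move=> z [b Bb /ANB]; move=> /subringD /(_ (subringM Bb Bx)); rewrite subrK.
split; first by apply: NM; exact: module0 mAN.
  move=> y z [b Bb yb] [c Bc zc]; exists (b + c); first exact: subringD.
  by rewrite mulrDl opprD addrACA; exact: moduleD.
move=> c z Bc [b Bb zb]; exists (c * b); first exact: subringM.
by rewrite -mulrA -mulrBr; exact: moduleM.
Qed.

(** How local statements become global: A is in practice a set of denominators
for which some property holds. *)
Lemma ideal_eq_ring A : ideal_of B A ->
  (forall N, maximal_in B N -> exists2 t, A t & ~ N t) -> A 1.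
Proof.
move=> iA big; apply: contrapT => A1.
have [N maxN AN] := exists_maximal iA A1.
by have [t /AN] := big N maxN.
Qed.

Section Maximal.
Variable N : set K.
Hypothesis maxN : maximal_in B N.

Lemma maximal_module : module_over B N. Proof. by case: maxN => -[]. Qed.
Lemma maximal_sub x : N x -> B x. Proof. by case: maxN => -[_ + _ _]; apply. Qed.

Lemma maximal_prime x y : B x -> B y -> N (x * y) -> N x \/ N y.
Proof.
move=> Bx By Nxy; have [Nx|Nx] := pselect (N x); [by left|right].
case: maxN => [[mN _] _ /(_ _ Bx Nx) [b Bb Nb]].
have -> : y = y * (1 - b * x) + b * (x * y).
  by rewrite mulrBr mulr1 mulrA [y * _]mulrC subrK.
by apply: moduleD => //; apply: moduleM.
Qed.

Lemma maximal_prod (I : Type) (s : seq I) (P : I -> K) :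
  (forall i, B (P i) /\ ~ N (P i)) ->
  B (\prod_(i <- s) P i) /\ ~ N (\prod_(i <- s) P i).
Proof.
move=> BNP; apply: (big_ind (fun x => B x /\ ~ N x)) => // [|x y [Bx Nx] [By Ny]].
  by split; [exact: subring1 | case: maxN].
split; first exact: subringM.
by case/maximal_prime.
Qed.

Lemma maximal_comaximal M : maximal_in B M -> M <> N ->
  exists2 x, N x & M (1 - x).
Proof.
move=> [iM M1 Mmax] MN.
have [x Nx Mx] : exists2 x, N x & ~ M x.
  apply: contrapT => /forall2NP NM; apply: MN; apply/seteqP; split; last first.
    by move=> x Nx; have [//|/contrapT] := NM x.
  move=> x Mx; apply: contrapT => Nx.
  case: maxN => [[mN _] N1 /(_ x (iM.2 x Mx) Nx) [b Bb Nb]].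
  have Mb : M (1 - b * x) by have [//|/contrapT] := NM (1 - b * x).
  by apply: M1; rewrite -(subrK (b * x) 1); apply: (moduleD iM.1) => //;
    apply: (moduleM iM.1).
have [b Bb Mb] := Mmax x (maximal_sub Nx) Mx.
by exists (b * x) => //; apply: (moduleM maximal_module).
Qed.
End Maximal.

(** The element e is a product of two elements congruent to 1 modulo N, one in
each of the other ideals. *)
Lemma maximal_separate N N1 N2 : maximal_in B N -> maximal_in B N1 -> maximal_in B N2 ->
  N <> N1 -> N <> N2 -> exists e, [/\ N1 e, N2 e & N (1 - e)].
Proof.
move=> maxN max1 max2 n1 n2.
have [a N1a Na] := maximal_comaximal max1 maxN n1.
have [b N2b Nb] := maximal_comaximal max2 maxN n2.
have Ba := maximal_sub max1 N1a; have Bb := maximal_sub max2 N2b.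
exists (a * b); split.
- by rewrite mulrC; exact: (moduleM (maximal_module max1)).
- exact: (moduleM (maximal_module max2)).
have -> : 1 - a * b = b * (1 - a) + (1 - b).
  by rewrite mulrBr mulr1 [b * a]mulrC [RHS]addrC addrA subrK.
by have mN := maximal_module maxN; apply: (moduleD mN) => //; exact: (moduleM mN).
Qed.
End Subring.
End SetRings.

(** * Tensor products, projectivity and flatness *)

Section TensorFacts.
Variables (R : comNzRingType) (P : lmodType R).

Lemma tens0r (N : lmodType R) (p : P) : tens p (0 : N) = 0.
Proof.
by have := (tens_bilinear _ _).2 p (-1) 0 (0 : N);
  rewrite /= scaler0 addr0 scaleN1r addNr.
Qed.

Lemma tensZl (N : lmodType R) a (p : P) (n : N) : tens (a *: p) n = a *: tens p n.
Proof.
apply: tens_ext => Q b bb; rewrite tens_liftZ // !tens_lift_tens //.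
have b0 : b 0 n = 0.
  by have := bb.1 n (-1) 0 0; rewrite /= scaler0 addr0 scaleN1r addNr.
by have := bb.1 n a p 0; rewrite /= !addr0 b0 addr0.
Qed.

Lemma tensZr (N : lmodType R) a (p : P) (n : N) : tens p (a *: n) = a *: tens p n.
Proof.
have := (tens_bilinear _ _).2 p a n (0 : N).
by rewrite /= !addr0 tens0r addr0.
Qed.

Lemma tensDr (N : lmodType R) (p : P) (m n : N) :
  tens p (m + n) = tens p m + tens p n.
Proof. by have := (tens_bilinear _ _).2 p 1 m n; rewrite /= !scale1r. Qed.

Lemma tensDl (N : lmodType R) (p q : P) (n : N) :
  tens (p + q) n = tens p n + tens q n.
Proof. by have := (tens_bilinear _ _).1 n 1 p q; rewrite /= !scale1r. Qed.

Lemma tens_suml (N : lmodType R) (I : Type) (s : seq I) (F : I -> P) (n : N) :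
  tens (\sum_(i <- s) F i) n = \sum_(i <- s) tens (F i) n.
Proof.
elim: s => [|i s IHs]; first by rewrite !big_nil -(scale0r (0 : P)) tensZl scale0r.
by rewrite !big_cons -IHs tensDl.
Qed.
End TensorFacts.

(** A definitional unfolding: the induced maps are computed on the chosen
representative of a tensor. *)
Lemma tens_mapE (R : comNzRingType) (M N N' : lmodType R) (g : {linear N -> N'})
  (x : tensor M N) : tens_map M g x = \sum_(p <- repr x) tens p.1 (g p.2).
Proof. by []. Qed.

Section Contraction.
Variables (R : comNzRingType) (P : lmodType R) (phi : {linear P -> R^o}).

(** A functional on P turns elements of P (x) N into elements of N. *)
Definition contract (N : lmodType R) : tensor P N -> N :=
  tens_lift (fun p n => phi p *: n).

Fact contract_bilinear (N : lmodType R) :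
  bilinear_for *:%R *:%R (fun (p : P) (n : N) => phi p *: n).
Proof.
split=> [n|p] a u v /=; first by rewrite linearP scalerDl scalerA.
by rewrite scalerDr !scalerA mulrC.
Qed.

HB.instance Definition _ (N : lmodType R) :=
  GRing.isLinear.Build R (tensor P N) N *:%R (@contract N)
    (tens_lift_linear (@contract_bilinear N)).

Lemma contract_tens (N : lmodType R) p (n : N) :
  contract (tens p n) = phi p *: n.
Proof. exact: tens_lift_tens (@contract_bilinear N). Qed.

Lemma contract_natural (N N' : lmodType R) (g : {linear N -> N'}) y :
  contract (tens_map P g y) = g (contract y).
Proof.
rewrite tens_mapE !linear_sum; apply: eq_bigr => q _.
by rewrite /= !contract_tens linearZ.
Qed.
End Contraction.

(** Two properties of a family of functionals characterize invertible modules: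
any two elements of P are proportional through each functional, and the trace
of the identity is 1.  For a fractional ideal the functionals are
multiplications, so the first property is commutativity of the product. *)
Section RankOne.
Variables (R : comNzRingType) (P : lmodType R) (n : nat).
Variables (a : 'I_n -> P) (phi : 'I_n -> {linear P -> R^o}).
Hypothesis rank_one : forall i x y, phi i x *: y = phi i y *: x.
Hypothesis trace1 : \sum_i phi i (a i) = 1.

Lemma rank_one_dual_basis x : x = \sum_i phi i x *: a i.
Proof.
rewrite -{1}[x]scale1r -trace1 scaler_suml.
by apply: eq_bigr => i _; rewrite rank_one.
Qed.

(** With [rank_one_retract], this makes N and P (x) N retracts of finite powers
of each other by natural maps, so that exactness can be moved both ways. *)
Lemma rank_one_contract (N : lmodType R) (y : tensor P N) :
  y = \sum_i tens (a i) (contract (phi i) y).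
Proof.
rewrite [y]tensE; set t := repr y.
have contrE i : tens (a i) (contract (phi i) (\sum_(p <- t) tens p.1 p.2))
    = \sum_(p <- t) @tens R P N (phi i p.1 *: a i) p.2.
  rewrite linear_sum; elim: t => [|p t IHt]; first by rewrite !big_nil tens0r.
  by rewrite !big_cons tensDr IHt /= contract_tens tensZr tensZl.
under [RHS]eq_bigr do rewrite contrE.
rewrite exchange_big; apply: eq_bigr => p _.
by rewrite -tens_suml -rank_one_dual_basis.
Qed.

Lemma rank_one_retract (N : lmodType R) (y : N) :
  y = \sum_i contract (phi i) (tens (a i) y).
Proof.
rewrite -{1}[y]scale1r -trace1 scaler_suml.
by apply: eq_bigr => i _; rewrite contract_tens.
Qed.

Lemma rank_one_faithfully_flat : faithfully_flat P.
Proof.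
move=> N1 N2 N3 f g; split=> ex y.
- split=> [gy0|[x <-]].
    have /choice [x xE] : forall i, exists x, f x = contract (phi i) y.
      by move=> i; apply/ex; rewrite -contract_natural gy0 linear0.
    exists (\sum_i tens (a i) (x i)).
    rewrite linear_sum [RHS]rank_one_contract; apply: eq_bigr => i _.
    by rewrite /= tens_map_tens xE.
  rewrite [x]tensE !linear_sum big1 // => p _ /=.
  rewrite !tens_map_tens (_ : g _ = 0) ?tens0r //.
  by apply/ex; exists p.2.
- split=> [gy0|[x <-]].
    have /choice [x xE] : forall i, exists x, tens_map P f x = tens (a i) y.
      by move=> i; apply/ex; rewrite /= tens_map_tens gy0 tens0r.
    exists (\sum_i contract (phi i) (x i)).
    rewrite linear_sum [RHS]rank_one_retract; apply: eq_bigr => i _.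
    by rewrite -contract_natural xE.
  rewrite [LHS]rank_one_retract big1 // => i _.
  rewrite -!tens_map_tens (_ : tens_map P g _ = 0) ?linear0 //.
  by apply/ex; exists (tens (a i) x).
Qed.

Lemma rank_one_projective : projective P.
Proof.
move=> M N g f gs.
have [r rE] := choice gs.
pose h x := \sum_i phi i x *: r (f (a i)).
have hl : linear h.
  move=> c x y; rewrite /h scaler_sumr -big_split; apply: eq_bigr => i _.
  by rewrite linearP scalerDl scalerA.
pose hL := GRing.isLinear.Build R P M *:%R _ hl.
pose h' : {linear P -> M} := HB.pack h hL.
exists h' => p; rewrite /h' /= /h linear_sum.
rewrite {2}[p]rank_one_dual_basis linear_sum; apply: eq_bigr => i _.
by rewrite !linearZ rE.
Qed.
End RankOne.

Section FreeCover.
Import freeg.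
Variables (R : comNzRingType) (P : lmodType R).

Definition free_eval : {freeg P / R} -> P := fglift id.
Fact free_eval_linear : linear free_eval.
Proof.
have [ev evE] : exists ev : {additive {freeg P / R} -> P}, free_eval =1 ev.
  pose add := GRing.isZmodMorphism.Build _ _ free_eval (lift_is_additive id).
  pose ev : {additive {freeg P / R} -> P} := HB.pack free_eval add.
  by exists ev.
have evU c x : ev << c *g x >> = c *: x by rewrite -evE /free_eval liftU.
move=> a u v; rewrite !evE raddfD /=; congr (_ + _).
have -> : ev u = \sum_(x <- dom u) coeff x u *: x.
  by rewrite -{1}[u]freeg_sumE raddf_sum; apply: eq_bigr => x _; rewrite /= evU.
rewrite [a *: u](_ : _ = fgscale a u) // /fgscale raddf_sum scaler_sumr.
by apply: eq_bigr => x _; rewrite /= evU scalerA.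
Qed.

HB.instance Definition _ :=
  GRing.isLinear.Build R {freeg P / R} P *:%R free_eval free_eval_linear.

Fact coeff_linear (x : P) : linear (coeff x : {freeg P / R} -> R^o).
Proof.
move=> a u v.
by rewrite coeffD coeffZ.
Qed.

HB.instance Definition _ (x : P) :=
  GRing.isLinear.Build R {freeg P / R} R^o *:%R (coeff x) (coeff_linear x).

(** Coordinates of a section of [free_eval]: only those in the support of the image
of x contribute to x. *)
Lemma projective_dual_basis : projective P ->
  exists phi : P -> {linear P -> R^o},
    forall x, exists s : seq P, x = \sum_(a <- s) phi a x *: a.
Proof.
move=> /(_ _ _ free_eval idfun) [y|h hE].
  by exists << y >>; rewrite /= /free_eval liftU scale1r.
exists (fun a => coeff a \o h) => x; exists (dom (h x)).
rewrite -{1}[x]hE -{1}[h x]freeg_sumE linear_sum; apply: eq_bigr => a _.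
by rewrite /= /free_eval liftU.
Qed.
End FreeCover.

Section Submodule.
Variables (R : comNzRingType) (V : lmodType R) (S : submodClosed V).

Record submod := Submod { submod_val :> V; submod_valP : submod_val \in S }.
HB.instance Definition _ := [isSub for submod_val].
HB.instance Definition _ := [Choice of submod by <:].
HB.instance Definition _ := [SubChoice_isSubLmodule of submod by <:].

Fact submod_val_linear : linear submod_val.
Proof. by []. Qed.
HB.instance Definition _ :=
  GRing.isLinear.Build R submod V *:%R submod_val submod_val_linear.
End Submodule.

Section Flat.
Variables (R : comNzRingType) (P : lmodType R).

Section Cocontraction.
Variables (N : lmodType R) (psi : {linear N -> R^o}).

(** The mirror image of [contract]: a functional on N gives a map P (x) N -> P. *)
Definition cocontract : tensor P N -> P := tens_lift (fun p n => psi n *: p).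

Fact cocontract_bilinear :
  bilinear_for *:%R *:%R (fun (p : P) (n : N) => psi n *: p).
Proof.
split=> [n|p] a u v /=; last by rewrite linearP scalerDl scalerA.
by rewrite scalerDr !scalerA mulrC.
Qed.

HB.instance Definition _ :=
  GRing.isLinear.Build R (tensor P N) P *:%R cocontract
    (tens_lift_linear cocontract_bilinear).

Lemma cocontract_tens p n : cocontract (tens p n) = psi n *: p.
Proof. exact: tens_lift_tens cocontract_bilinear. Qed.
End Cocontraction.

Hypothesis ffP : faithfully_flat P.

(** If N P = P for an ideal N, then P (x) N -> P (x) R is onto; by faithfulness
so is the inclusion of N in R. *)
Lemma faithfully_flat_proper (N : set R) :
    N 0 -> (forall a u v, N u -> N v -> N (a * u + v)) ->
    (forall x : P, exists2 s : seq (R * P),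
      forall q, q \in s -> N q.1 & x = \sum_(q <- s) q.1 *: q.2) ->
  N 1.
Proof.
move=> N0 NP NPall.
pose pN : {pred R^o} := fun u => `[< N u >].
have pN_closed : subsemimod_closed pN.
  split; first split; first exact/asboolP.
    by move=> u v /asboolP Nu /asboolP Nv; apply/asboolP; rewrite -[u]mul1r; apply: NP.
  by move=> a v /asboolP Nv; apply/asboolP; have := NP a _ _ Nv N0; rewrite addr0.
pose pNs := GRing.isSubmodClosed.Build R R^o pN pN_closed.
pose S : submodClosed R^o := HB.pack pN pNs.
pose f : {linear submod S -> R^o} := @submod_val R R^o S.
pose g : {linear R^o -> R^o} := \0.
suff : exact_at f g.
  by case/(_ 1) => /(_ erefl) [[x Sx] <-] _; apply/asboolP.
apply/ffP => y; split=> [_|_]; last first.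
  by rewrite [y]tensE linear_sum big1 // => q _ /=; rewrite tens_map_tens tens0r.
suff [h hE] : exists h : P * R^o -> tensor P (submod S),
    forall q, tens_map P f (h q) = tens q.1 q.2.
  exists (\sum_(q <- repr y) h q); rewrite [RHS]tensE linear_sum.
  by apply: eq_bigr => q _; exact: hE.
suff /choice [h hE] : forall q : P * R^o, exists t,
    tens_map P f t = tens q.1 q.2 by exists h.
pose e (u : R) : submod S := insubd (0 : submod S) (u : R^o).
have eE u : N u -> f (e u) = u.
  by move=> Nu; apply: (insubdK (0 : submod S)); apply/asboolP.
move=> [p r] /=; have [s sN ->] := NPall p.
exists (\sum_(q <- s) tens q.2 ((r : R) *: e q.1)).
rewrite linear_sum tens_suml big_seq [RHS]big_seq.
apply: eq_bigr => q /sN Nq; rewrite /= tens_map_tens tensZl -tensZr.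
by rewrite linearZ eE //; congr tens; exact: mulrC.
Qed.

(** The relation says that x (x) (1, 0) + y (x) (0, 1) is killed by the map
induced by (c, d) |-> a c + b d.  By flatness this tensor comes from P tensored
with the kernel, and the two coordinates of a preimage are the required
decompositions. *)
Lemma flat_equational_criterion (a b : R) (x y : P) :
    a *: x + b *: y = 0 ->
  exists2 s : seq (R * R * P),
    forall q, q \in s -> a * q.1.1 + b * q.1.2 = 0 &
    x = \sum_(q <- s) q.1.1 *: q.2 /\ y = \sum_(q <- s) q.1.2 *: q.2.
Proof.
move=> rel; pose W : lmodType R := (R^o * R^o)%type.
have [g gE] : exists g : {linear W -> R^o}, forall u, g u = a * u.1 + b * u.2.
  pose g (u : W) : R^o := a * u.1 + b * u.2.
  have g_linear : linear g.
    move=> c u v; rewrite /g /= !mulrDr scalerDr addrACA.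
    by congr (_ + _ + _); rewrite [LHS]mulrCA.
  pose gL := GRing.isLinear.Build R W R^o *:%R g g_linear.
  pose g' : {linear W -> R^o} := HB.pack g gL.
  by exists g'.
pose pS : {pred W} := fun u => g u == 0.
have pS_closed : subsemimod_closed pS.
  split; first split; first by apply/eqP; rewrite linear0.
    by move=> u v /eqP gu /eqP gv; apply/eqP; rewrite linearD gu gv addr0.
  by move=> c v /eqP gv; apply/eqP; rewrite linearZ_LR gv scaler0.
pose pSs := GRing.isSubmodClosed.Build R W pS pS_closed.
pose S : submodClosed W := HB.pack pS pSs.
pose f : {linear submod S -> W} := @submod_val R W S.
have ex : exact_at f g.
  move=> u; split=> [gu0|[[v /eqP gv] <-] //].
  by exists (Submod (introT eqP gu0 : u \in S)).
pose w : tensor P W := tens x (1, 0) + tens y (0, 1).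
have [t tE] : exists t, tens_map P f t = w.
  apply/(ffP f g).1 => //; rewrite linearD /= !tens_map_tens !gE /=.
  rewrite !mulr0 addr0 add0r.
  have sc (c : R) p : @tens R P R^o p (c * 1) = @tens R P R^o (c *: p) 1.
    by rewrite tensZl -tensZr.
  by rewrite !sc -[LHS](@tensDl R P R^o) rel -(scale0r (0 : P)) tensZl scale0r.
have coordP (psi : {linear W -> R^o}) :
    psi (1, 0) *: x + psi (0, 1) *: y = \sum_(p <- repr t) psi (f p.2) *: p.1.
  rewrite -!cocontract_tens -linearD -[_ + _]/w -tE tens_mapE linear_sum.
  by apply: eq_bigr => p _; exact: cocontract_tens.
pose s := [seq (((f p.2).1 : R, (f p.2).2 : R), p.1) | p <- repr t].
exists s; first by move=> _ /mapP[[p [u /= /eqP gu]] _ ->] /=; rewrite -gE.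
split; [have := coordP fst | have := coordP snd];
  by rewrite /= scale0r scale1r ?addr0 ?add0r big_map => ->.
Qed.
End Flat.

(** * Fractional ideals over their endomorphism rings *)

Section FracIdeals.
Variable D : idomainType.
Local Notation K := {fraction D}.
Local Notation "x %:F" := (@FracField.tofrac D x).
Local Notation dom := (@dom_set D).

Lemma dom_tofrac (d : D) : dom d%:F. Proof. by exists d. Qed.

Lemma dom_subring : subring_set dom.
Proof.
split; first by exists 1; rewrite ?rmorph1.
  by move=> _ _ [x _ <-] [y _ <-]; exists (x - y); rewrite ?rmorphB.
by move=> _ _ [x _ <-] [y _ <-]; exists (x * y); rewrite ?rmorphM.
Qed.

(** The product of I and (E : I) for E = (I : I): the trace ideal of the E-module
I.  It contains 1 exactly when I is invertible in E. *)
Definition trace_ideal (I : set K) : set K :=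
  [set z | exists2 s : seq (K * K),
     forall q, q \in s -> I q.1 /\ colon (colon I I) I q.2 &
     z = \sum_(q <- s) q.1 * q.2].

Section OneIdeal.
Variable I : fracIdeal D.
Local Notation E := (colon I I).
Local Notation Iset := (ideal_set I).

Lemma endo_subring : subring_set E.
Proof.
have [E1 EB EM] := endo_subring_closed I.
split; first exact/endoP.
  by move=> x y /endoP Ex /endoP Ey; apply/endoP; exact: EB.
by move=> x y /endoP Ex /endoP Ey; apply/endoP; exact: EM.
Qed.

Lemma ideal_submodule : is_submodule I. Proof. by case: (ideal_setP I). Qed.

Lemma dom_sub_endo : dom `<=` E.
Proof. by move=> _ [d _ <-] x Ix; case: ideal_submodule => _ _; apply. Qed.

Lemma trace_ideal_ideal : ideal_of E (trace_ideal I).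
Proof.
split; last first.
  move=> _ [s sP ->]; rewrite big_seq; apply: (big_ind E).
  - exact: subring0 endo_subring.
  - by move=> x y; apply: subringD endo_subring _ _.
  - by move=> q /sP [Iq Eq]; rewrite mulrC; exact: Eq.
split; first by exists [::]; rewrite ?big_nil.
  move=> _ _ [s sP ->] [t tP ->]; exists (s ++ t); last by rewrite big_cat.
  by move=> q; rewrite mem_cat => /orP[/sP|/tP].
move=> b _ Eb [s sP ->]; exists [seq (b * q.1, q.2) | q <- s].
  move=> _ /mapP[q /sP [Iq Eq] ->]; split => //=; exact: Eb.
by rewrite mulr_sumr big_map; apply: eq_bigr => q _; rewrite mulrA.
Qed.

Definition mk_endo x (Ex : E x) : endo I := Endo (introT (endoP I x) Ex).
Definition mk_ideal x (Ix : Iset x) : ideal_mod I :=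
  IdealMod (introT (ideal_predP I x) Ix).

Lemma endo_val_in (a : endo I) : E (endo_val a).
Proof. exact/endoP/endo_valP. Qed.
Lemma ideal_val_in (x : ideal_mod I) : Iset (ideal_val x).
Proof. exact/ideal_predP/ideal_valP. Qed.

Section Functional.
Variables (b : K) (Eb : colon E I b).
Definition mul_endo (x : ideal_mod I) : (endo I)^o :=
  mk_endo (Eb (ideal_val_in x)).
Fact mul_endo_linear : linear mul_endo.
Proof. by move=> a x y; apply: val_inj; rewrite /= mulrDr mulrCA. Qed.
HB.instance Definition _ :=
  GRing.isLinear.Build (endo I) (ideal_mod I) (endo I)^o *:%R mul_endo
    mul_endo_linear.
End Functional.

Lemma endo_val_sum (T : Type) (s : seq T) (F : T -> endo I) :
  endo_val (\sum_(i <- s) F i) = \sum_(i <- s) endo_val (F i).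
Proof. exact: (big_morph (@endo_val D I) (fun _ _ => erefl) erefl). Qed.

Lemma ideal_val_sum (T : Type) (s : seq T) (F : T -> ideal_mod I) :
  ideal_val (\sum_(i <- s) F i) = \sum_(i <- s) ideal_val (F i).
Proof. exact: (big_morph (@ideal_val D I) (fun _ _ => erefl) erefl). Qed.

Lemma invertible_projective_faithfully_flat : trace_ideal I 1 ->
  stable_ideal I /\ faithfully_flat_in_endo I.
Proof.
case=> s sP one.
have sI (i : 'I_(size s)) : Iset (tnth (in_tuple s) i).1 /\
    colon E I (tnth (in_tuple s) i).2 by apply: sP; exact: mem_tnth.
pose a i := mk_ideal (sI i).1.
pose phi i : {linear ideal_mod I -> (endo I)^o} := mul_endo (sI i).2.
have rk i x y : phi i x *: y = phi i y *: x.
  by apply: val_inj; rewrite /= mulrAC.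
have tr : \sum_i phi i (a i) = 1.
  apply: val_inj; rewrite /= [LHS]endo_val_sum one [RHS]big_tnth.
  by apply: eq_bigr => i _ /=; rewrite mulrC.
split; [exact: rank_one_projective rk tr | exact: rank_one_faithfully_flat rk tr].
Qed.

Lemma conductor : exists2 d : D, d != 0 & forall x, Iset x -> dom (d%:F * x).
Proof. by case: (ideal_setP I). Qed.

(** A functional phi on I is multiplication by phi x0 / x0: for a common denominator
d of the elements of I, both d x0 and d y act on I as scalars, and they send y
and x0 to the same element. *)
Lemma projective_invertible : nonzero I -> stable_ideal I -> trace_ideal I 1.
Proof.
move=> [x0 Ix0 x0_neq0] /projective_dual_basis [phi phiP].
have [d d_neq0 dI] := conductor.
have dF_neq0 : d%:F != 0 by rewrite tofrac_eq0.
pose xx := mk_ideal Ix0.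
have phiE a (y : ideal_mod I) :
    endo_val (phi a y) = endo_val (phi a xx) / x0 * ideal_val y.
  pose c := mk_endo (dom_sub_endo (dI _ Ix0)).
  pose e := mk_endo (dom_sub_endo (dI _ (ideal_val_in y))).
  have ce : c *: y = e *: xx by apply: val_inj; rewrite /= mulrAC.
  have /(congr1 (@endo_val D I)) := congr1 (phi a) ce.
  rewrite !linearZ /= -!mulrA => /(mulfI dF_neq0) xyE.
  by apply: (mulfI x0_neq0); rewrite xyE mulrC mulrCA mulVKf.
have [s sE] := phiP xx.
exists [seq (ideal_val a, endo_val (phi a xx) / x0) | a <- s].
  move=> _ /mapP[a _ ->]; split; first exact: ideal_val_in.
  by move=> y Iy; have := phiE a (mk_ideal Iy); rewrite /= => <-; exact: endo_val_in.
rewrite big_map /=.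
have {sE} := congr1 (@ideal_val D I) sE; rewrite ideal_val_sum /= => sE.
apply: (mulfI x0_neq0); rewrite mulr1 mulr_sumr {1}sE; apply: eq_bigr => a _.
by rewrite mulrCA [x0 * _]mulrC divfK // mulrC.
Qed.

(** The element x generates the localization of I at N. *)
Definition local_generator (N : set K) x : Prop :=
  Iset x /\ forall y, Iset y ->
    exists t, [/\ E t, ~ N t & exists2 c, E c & t * y = c * x].

(** The generator is any x outside N I.  In a decomposition of x given by the
equational criterion for (d y) x - (d x) y = 0, some coefficient c is outside N,
and y c is a multiple of x. *)
Lemma faithfully_flat_local_generator N : faithfully_flat_in_endo I -> maximal_in E N ->
  exists x, local_generator N x.
Proof.
move=> ffI maxN; have mN := maximal_module maxN.
have [x xN] : exists x : ideal_mod I, forall s : seq (endo I * ideal_mod I),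
    (forall q, q \in s -> N (endo_val q.1)) -> x <> \sum_(q <- s) q.1 *: q.2.
  apply: contrapT => /forallNP allN; have [_ N1 _] := maxN; apply: N1.
  apply: (@faithfully_flat_proper _ _ ffI [set a | N (endo_val a)]).
  - exact: module0 mN.
  - move=> a u v Nu Nv; apply: (moduleD mN) => //.
    by apply: (moduleM mN) => //; exact: endo_val_in.
  - move=> x; apply: contrapT => noS; apply: (allN x) => s sN xE.
    by apply: noS; exists s.
exists (ideal_val x); split; first exact: ideal_val_in.
move=> y0 Iy0; pose y := mk_ideal Iy0.
have [d d_neq0 dI] := conductor.
have dF_neq0 : d%:F != 0 by rewrite tofrac_eq0.
pose a := mk_endo (dom_sub_endo (dI _ Iy0)).
pose b := mk_endo (dom_sub_endo (dI _ (ideal_val_in x))).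
have rel : a *: x + (- b) *: y = 0.
  by rewrite scaleNr; apply/eqP; rewrite subr_eq0; apply/eqP/val_inj; rewrite /= mulrAC.
have [s sP [xE _]] := flat_equational_criterion ffI rel.
have [q qs Nq] : exists2 q, q \in s & ~ N (endo_val q.1.1).
  apply: contrapT => /forall2NP sN.
  apply: (xN [seq (q.1.1, q.2) | q <- s]); last by rewrite big_map.
  by move=> _ /mapP[q qs ->]; case: (sN q) => // /contrapT.
exists (endo_val q.1.1); split => //; first exact: endo_val_in.
exists (endo_val q.1.2); first exact: endo_val_in.
have := sP q qs; rewrite mulNr => /subr0_eq /(congr1 (@endo_val D I)) /=.
by rewrite -!mulrA => /(mulfI dF_neq0); rewrite mulrC => ->; rewrite mulrC.
Qed.

(** Finite generation over E is expressed by induction: a module containing the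
finitely many elements of xs contains I.  If x generates I at N, the product T
of denominators, one for each generator, satisfies T I <= x E; hence T / x is
in (E : I) and T is in the trace ideal. *)
Lemma fin_gen_invertible (xs : seq K) : nonzero I ->
    (forall S, module_over E S -> (forall x, x \in xs -> S x) -> I `<=` S) ->
    (forall x, x \in xs -> Iset x) ->
  faithfully_flat_in_endo I -> trace_ideal I 1.
Proof.
move=> [z Iz z_neq0] gen xsI ffI.
apply: (ideal_eq_ring endo_subring trace_ideal_ideal) => N maxN.
have mN := maximal_module maxN.
have [x [Ix xP]] := faithfully_flat_local_generator ffI maxN.
have x_neq0 : x != 0.
  have [t [_ Nt [c _ tz]]] := xP z Iz; apply/eqP => x0; apply: Nt.
  move/eqP: tz; rewrite x0 mulr0 mulf_eq0 (negPf z_neq0) orbF => /eqP ->.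
  exact: module0 mN.
have /choice [t tP] : forall i : 'I_(size xs), exists t, [/\ E t, ~ N t &
    exists2 c, E c & t * tnth (in_tuple xs) i = c * x].
  by move=> i; apply/xP/xsI; exact: mem_tnth.
pose T := \prod_i t i.
have [ET NT] : E T /\ ~ N T.
  by apply: (maximal_prod endo_subring maxN) => i; have [] := tP i.
exists T => //; exists [:: (x, T / x)]; last first.
  by rewrite big_seq1 /= mulrCA divff ?mulr1.
move=> _ /[1!inE] /eqP -> /=; split => // y Iy.
pose S := [set y | E (T * y / x)].
suff /(_ y Iy) : I `<=` S by rewrite /S /= mulrAC.
have rE := endo_subring.
apply: gen.
  split; rewrite /S /=; first by rewrite mulr0 mul0r; exact: subring0 rE.
    by move=> u v Eu Ev; rewrite mulrDr mulrDl; exact: (subringD rE).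
  by move=> c u Ec Eu; rewrite mulrCA -mulrA; exact: (subringM rE).
move=> u /(tnthP (in_tuple xs)) [i ->]; rewrite /S /=.
have [_ _ [c Ec cE]] := tP i.
rewrite /T (bigD1 i) //= [t i * _ * _]mulrAC cE [c * x * _]mulrAC mulfK //.
apply: (subringM rE) => //; apply: (big_ind E) => //.
- exact: subring1 rE.
- by move=> ? ?; exact: (subringM rE).
- by move=> j _; have [] := tP j.
Qed.
End OneIdeal.
End FracIdeals.

(** * Ideals with two generators *)

(** Expanding p p = p p (p u + q v), and computing u p p q and u p q q in two ways,
gives three quadratic relations between p and q.  The first four equations are
these relations solved for p p or q q; the last one is the second relation,
where modulo p + q the product p q may be replaced by - q q and p p by q q.
Modulo any maximal ideal one of the five coefficients on the left is nonzero,
because (1 - al) + (al - de + ga - be) + de - ga + be = 1. *)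
Lemma quadratic_identities (R : comNzRingType)
    (p q u v al be ga de rh ta a b : R) :
    p * u + q * v = 1 ->
    u * p * p = al * p + be * q -> u * p * q = ga * p + de * q ->
    u * q * q = rh * p + ta * q -> v * p * p = a * p + b * q ->
  [/\ (1 - al) * (p * p) = q * ((be + a) * p + b * q),
      de * (q * q) = p * (rh * p + (ta - ga) * q),
      ga * (p * p) = q * ((al - de) * p + be * q),
      be * (q * q) = p * (ga * p + (de - al) * q) &
      (al - de + ga - be) * (q * q) = (p + q) * (- ga * p + (al - de + ga) * q)].
Proof.
move=> one E1 E2 E3 E4.
have pp : p * p = p * (al * p + be * q) + q * (a * p + b * q).
  by rewrite -E1 -E4 -[LHS]mulr1 -one; ring.
have pq : p * (ga * p + de * q) = q * (al * p + be * q).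
  by rewrite -E1 -E2; ring.
have qq : p * (rh * p + ta * q) = q * (ga * p + de * q).
  by rewrite -E3 -E2; ring.
have eq0 (x y l r : R) : l = r -> x - y = l - r -> x = y.
  by move=> -> /eqP; rewrite subrr subr_eq0 => /eqP.
split.
- by apply: (eq0 _ _ _ _ pp); ring.
- by apply: (eq0 _ _ _ _ (esym qq)); ring.
- by apply: (eq0 _ _ _ _ pq); ring.
- by apply: (eq0 _ _ _ _ (esym pq)); ring.
- by apply: (eq0 _ _ _ _ pq); ring.
Qed.

Section TwoGenerators.
Variable D : idomainType.
Local Notation K := {fraction D}.
Local Notation "x %:F" := (@FracField.tofrac D x).
Local Notation dom := (@dom_set D).
Let rD := dom_subring D.

Definition span2 (p q : K) : set K :=
  [set x | exists a b : D, x = a%:F * p + b%:F * q].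

Lemma span2_submodule p q : is_submodule (span2 p q).
Proof.
split; first by exists 0, 0; rewrite rmorph0 !mul0r addr0.
  move=> _ _ [a [b ->]] [c [d ->]]; exists (a + c), (b + d).
  by rewrite !rmorphD /= !mulrDl addrACA.
move=> c _ [a [b ->]]; exists (c * a), (c * b).
by rewrite !rmorphM /= mulrDr !mulrA.
Qed.

Lemma span2l p q : span2 p q p.
Proof. by exists 1, 0; rewrite rmorph1 rmorph0 mul1r mul0r addr0. Qed.
Lemma span2r p q : span2 p q q.
Proof. by exists 0, 1; rewrite rmorph1 rmorph0 mul1r mul0r add0r. Qed.

Lemma span2_trace p q : trace_ideal (span2 p q) 1 ->
  exists u v : K, [/\ colon (colon (span2 p q) (span2 p q)) (span2 p q) u,
    colon (colon (span2 p q) (span2 p q)) (span2 p q) v & p * u + q * v = 1].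
Proof.
set I := span2 p q; set E := colon I I; case=> s sP ->.
have [I0 ID IM] := span2_submodule p q.
have C0 : colon E I 0 by move=> x Ix y Iy; rewrite !mul0r.
have CD u v : colon E I u -> colon E I v -> colon E I (u + v).
  by move=> Cu Cv x Ix y Iy; rewrite !mulrDl; apply: ID; [apply: Cu | apply: Cv].
have CM (a : D) u : colon E I u -> colon E I (a%:F * u).
  by move=> Cu x Ix y Iy; rewrite -!mulrA; apply: IM; rewrite mulrA; apply: Cu.
rewrite big_seq; elim/big_rec: _ => [|r z /sP [[a [b rE]] Cr] [u [v [Cu Cv <-]]]].
  by exists 0, 0; rewrite !mulr0 addr0.
exists (a%:F * r.2 + u), (b%:F * r.2 + v); split; try by apply/CD => //; exact/CM.
by rewrite rE !mulrDr addrACA mulrDl; congr (_ + _ + _); rewrite mulrCA mulrA.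
Qed.

(** The ideal (p, q) has a local generator at M among p, q and p + q; the relation
says this for the square of one of the other two elements. *)
Lemma quadratic_relation p q M : trace_ideal (span2 p q) 1 -> maximal_in dom M ->
  exists s : D, ~ M s%:F /\
    [\/ exists2 w, span2 p q w & s%:F * (p * p) = q * w,
        exists2 w, span2 p q w & s%:F * (q * q) = p * w |
        exists2 w, span2 p q w & s%:F * (q * q) = (p + q) * w].
Proof.
move=> /span2_trace [u [v [Cu Cv one]]] maxM.
have mM := maximal_module maxM.
have MF (a b : D) : M a%:F -> M (b%:F * a%:F) by apply: (moduleM mM); exact: dom_tofrac.
have [al [be E1]] := Cu _ (span2l p q) _ (span2l p q).
have [ga [de E2]] := Cu _ (span2l p q) _ (span2r p q).
have [rh [ta E4]] := Cu _ (span2r p q) _ (span2r p q).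
have [a [b E3]] := Cv _ (span2l p q) _ (span2l p q).
have [R1 R2 R3 R4 R5] := quadratic_identities one E1 E2 E4 E3.
have spanF (c d : D) : span2 p q (c%:F * p + d%:F * q) by exists c, d.
have [a1|a1] := pselect (M (1 - al)%:F); last first.
  exists (1 - al); split => //; constructor 1.
  exists ((be + a)%:F * p + b%:F * q) => //.
  by rewrite rmorphB rmorphD rmorph1.
have [d1|d1] := pselect (M de%:F); last first.
  exists de; split => //; constructor 2; exists (rh%:F * p + (ta - ga)%:F * q) => //.
  by rewrite rmorphB.
have [g1|g1] := pselect (M ga%:F); last first.
  exists ga; split => //; constructor 1; exists ((al - de)%:F * p + be%:F * q) => //.
  by rewrite rmorphB.
have [b1|b1] := pselect (M be%:F); last first.
  exists be; split => //; constructor 2; exists (ga%:F * p + (de - al)%:F * q) => //.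
  by rewrite rmorphB.
exists (al - de + ga - be); split; last first.
  constructor 3; exists ((- ga)%:F * p + (al - de + ga)%:F * q) => //.
  by rewrite !(rmorphB, rmorphD, rmorphN).
have [_ M1 _] := maxM => s1; apply: M1.
(* All five coefficients lie in M, although they combine to 1. *)
have /(congr1 (@FracField.tofrac D)) :
    1 = (1 - al) + (al - de + ga - be) + de - ga + be :> D by ring.
rewrite rmorph1 => ->.
rewrite rmorphD rmorphB rmorphD rmorphD.
by apply: (moduleD mM) => //; apply: (moduleB rD mM) => //;
  do 2![apply: (moduleD mM) => //].
Qed.
End TwoGenerators.

(** * Domains whose ideals are faithfully flat *)

Section FaithfullyFlatDomain.
Variable D : idomainType.
Local Notation K := {fraction D}.
Local Notation "x %:F" := (@FracField.tofrac D x).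
Local Notation dom := (@dom_set D).
Let rD := dom_subring D.
Hypothesis ffD : forall I : fracIdeal D, nonzero I -> faithfully_flat_in_endo I.

Lemma submodule_over_dom (I : set K) : is_submodule I -> module_over dom I.
Proof. by case=> I0 ID IM; split=> // _ x [d _ <-]; exact: IM. Qed.

Lemma module_over_sub (B C S : set K) : B `<=` C -> module_over C S -> module_over B S.
Proof. by move=> BC [S0 SD SM]; split=> // b x /BC; exact: SM. Qed.

Lemma span2_invertible (e : D) p q : e != 0 -> dom (e%:F * p) -> dom (e%:F * q) ->
  p != 0 -> trace_ideal (span2 p q) 1.
Proof.
move=> e0 ep eq p0.
have iI : is_ideal (span2 p q).
  split; first exact: span2_submodule.
  exists e => // _ [a [b ->]]; rewrite mulrDr ![e%:F * (_ * _)]mulrCA.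
  by apply: (subringD rD); apply: (subringM rD) => //; exact: dom_tofrac.
pose I := FracIdeal iI.
apply: (@fin_gen_invertible _ I [:: p; q]).
- by exists p => //; exact: span2l.
- move=> S mS Sg _ [a [b ->]].
  have mS' := module_over_sub (@dom_sub_endo _ I) mS.
  by apply: (moduleD mS'); apply: (moduleM mS');
    try exact: dom_tofrac; apply: Sg; rewrite !inE eqxx ?orbT.
- by move=> x; rewrite !inE => /orP[] /eqP ->; [exact: span2l | exact: span2r].
- by apply: ffD; exists p => //; exact: span2l.
Qed.

Section Endo.
Variable I : fracIdeal D.
Hypothesis I_neq0 : nonzero I.
Local Notation E := (colon I I).
Let rE := endo_subring I.

Lemma endo_conductor : exists2 e : D, e != 0 & forall b, E b -> dom (e%:F * b).
Proof.
have [y Iy y_neq0] := I_neq0; have [d d_neq0 dI] := conductor I.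
have [e _ eE] := dI y Iy; exists e.
  by rewrite -tofrac_eq0 eE mulf_neq0 // tofrac_eq0.
by move=> b Eb; rewrite eE -mulrA [y * b]mulrC; apply/dI/Eb.
Qed.

(** The points p : q of the projective line over the three residue fields are
0, infinity and -1, so that locally p, q and p + q each fail to be a generator
of (p, q) somewhere. *)
Lemma at_most_two_above M N1 N2 N3 : maximal_in dom M ->
    (forall N, N \in [:: N1; N2; N3] -> maximal_in E N /\ N `&` dom `<=` M) ->
  uniq [:: N1; N2; N3] -> False.
Proof.
move=> maxM NP /=; rewrite !inE negb_or andbT.
case/andP => [/andP[/eqP n12 /eqP n13] /eqP n23].
have [max1 N1M] : maximal_in E N1 /\ N1 `&` dom `<=` M by apply: NP; rewrite !inE eqxx.
have [max2 N2M] : maximal_in E N2 /\ N2 `&` dom `<=` M.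
  by apply: NP; rewrite !inE eqxx orbT.
have [max3 N3M] : maximal_in E N3 /\ N3 `&` dom `<=` M.
  by apply: NP; rewrite !inE eqxx !orbT.
have [e1 [e12 e13 e11]] := maximal_separate max1 max2 max3 n12 n13.
have [e2 [e21 e23 e22]] := maximal_separate max2 max1 max3 (nesym n12) n23.
have [e3 [e31 e32 e33]] := maximal_separate max3 max1 max2 (nesym n13) (nesym n23).
have m1 := maximal_module max1.
have m2 := maximal_module max2.
have m3 := maximal_module max3.
(* p lies in N1 only, q in N2 only, and p + q in N3 only. *)
pose p := e2 + e3; pose q := e1 - e3.
have unit_mod N x : maximal_in E N -> N (1 - x) -> ~ N x.
  move=> [[mN _] N1' _] Nx1 Nx; apply: N1'.
  by rewrite -(subrK x 1); exact: (moduleD mN).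
have N1p : N1 p by exact: (moduleD m1).
have N2q : N2 q by exact: (moduleB rE m2).
have N3pq : N3 (p + q).
  have -> : p + q = e2 + e1 by rewrite /p /q addrACA subrr addr0.
  exact: (moduleD m3).
have N2p : ~ N2 p.
  apply: unit_mod max2 _; rewrite /p opprD addrA.
  exact: (moduleB rE m2).
have N1q : ~ N1 q.
  apply: unit_mod max1 _; rewrite /q opprB addrCA addrC.
  exact: (moduleD m1).
have N3q : ~ N3 q.
  move=> /(moduleN rE m3); rewrite opprB; apply: unit_mod max3 _.
  by rewrite opprB addrCA addrC; exact: (moduleD m3).
have Ep : E p := maximal_sub max1 N1p.
have Eq : E q := maximal_sub max2 N2q.
have [e e_neq0 eE] := endo_conductor.
have p_neq0 : p != 0 by apply/eqP => p0; apply: N2p; rewrite p0; exact: module0 m2.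
have spanE w : span2 p q w -> E w.
  by move=> [a [b ->]]; apply: (subringD rE); apply: (subringM rE) => //;
    apply/dom_sub_endo/dom_tofrac.
have absurd N (s : D) x y w : maximal_in E N -> N `&` dom `<=` M -> ~ M s%:F ->
    E x -> N y -> span2 p q w -> s%:F * (x * x) = y * w -> ~ N x -> False.
  move=> maxN NM Ms Ex Ny /spanE Ew swx Nx.
  have Es : E s%:F := dom_sub_endo (dom_tofrac s).
  have Exx : E (x * x) := subringM rE Ex Ex.
  have : N (s%:F * (x * x)).
    by rewrite swx mulrC; apply: moduleM (maximal_module maxN) _ _.
  case/(maximal_prime maxN Es Exx) => [Ns|].
    by apply/Ms/NM; split => //; exact: dom_tofrac.
  by case/(maximal_prime maxN Ex Ex).
have inv := span2_invertible e_neq0 (eE _ Ep) (eE _ Eq) p_neq0.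
have [s [Ms]] := quadratic_relation inv maxM.
case=> -[w Iw sw].
- exact: (absurd N2 s p q w).
- exact: (absurd N1 s q p w).
- exact: (absurd N3 s q (p + q) w).
Qed.
End Endo.

(** If the t-closure of M were larger than M, enlarging J by one element m of M
would give a finitely generated J' in M whose divisorial closure contains 1.
Then (D : J') = D, the endomorphism ring of J' is D, and invertibility of J'
puts 1 in J'. *)
Lemma maximal_t_closed M x : maximal_in dom M -> t_closure M x -> M x.
Proof.
move=> maxM [J [mJ J_neq0 [n [g JE]] JM Jvx]]; apply: contrapT => Mx.
have mM := maximal_module maxM.
have domJ y : J y -> dom y by move/JM; exact: maximal_sub maxM y.
have Dx : dom x.
  rewrite -[x]mulr1; apply: Jvx => y; rewrite mul1r; exact: domJ.
have [_ M1 /(_ _ Dx Mx) [b Db Mbx]] := maxM.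
pose m := 1 - b * x.
pose J' : set K := [set z | exists c y, [/\ dom c, J y & z = c * m + y]].
have mJd : module_over dom J := submodule_over_dom mJ.
have J'P : is_submodule J'.
  split.
  - exists 0, 0; split; [exact: subring0 rD | exact: module0 mJd |].
    by rewrite mul0r addr0.
  - move=> _ _ [c [y [Dc Jy ->]]] [d [z [Dd Jz ->]]]; exists (c + d), (y + z).
    by split; [exact: (subringD rD) | exact: (moduleD mJd) | rewrite mulrDl addrACA].
  - move=> d _ [c [y [Dc Jy ->]]]; exists (d%:F * c), (d%:F * y).
    have Dd := dom_tofrac d.
    by split; [exact: (subringM rD) | exact: (moduleM mJd) | rewrite mulrDr mulrA].
have J'M : J' `<=` M.
  by move=> _ [c [y [Dc Jy ->]]]; apply: (moduleD mM);
    [exact: (moduleM mM) | exact: JM].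
have JJ' : J `<=` J'.
  by move=> y Jy; exists 0, y; split => //; [exact: subring0 rD | rewrite mul0r add0r].
have J'm : J' m.
  exists 1, 0; split; [exact: subring1 rD | exact: module0 mJd |].
  by rewrite mul1r addr0.
have iJ' : is_ideal J'.
  split => //; exists 1; first exact: oner_neq0.
  by move=> y /J'M; rewrite rmorph1 mul1r; exact: maximal_sub maxM y.
pose I := FracIdeal iJ'.
have I_neq0 : nonzero I by have [y Jy y0] := J_neq0; exists y => //; exact: JJ'.
(* 1 = m + b x lies in the divisorial closure of J'. *)
have colonD y : colon dom J' y -> dom y.
  move=> Cy; have -> : y = y * m + b * (x * y).
    by rewrite /m mulrBr mulr1 [x * y]mulrC mulrCA subrK.
  apply: (subringD rD); first exact: Cy.
  apply: (subringM rD) => //; apply: Jvx => z Jz; exact/Cy/JJ'.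
have [] : trace_ideal I 1.
  apply: (@fin_gen_invertible _ I (m :: [seq g i | i <- enum 'I_n])) => //.
  - move=> S mS Sg _ [c [y [Dc Jy ->]]].
    have mS' := module_over_sub (@dom_sub_endo _ I) mS.
    apply: (moduleD mS').
      by apply: (moduleM mS') => //; apply: Sg; rewrite inE eqxx.
    move: Jy; rewrite JE => -[d ->]; apply: (big_ind S).
    + exact: module0 mS.
    + by move=> ? ?; exact: (moduleD mS).
    + move=> i _; apply: (moduleM mS'); first exact: dom_tofrac.
      by apply: Sg; rewrite inE map_f ?orbT // mem_enum.
  - move=> y; rewrite inE => /orP[/eqP -> //|/mapP[i _ ->]]; apply: JJ'.
    rewrite JE; exists (fun j => if j == i then 1 else 0).
    rewrite (bigD1 i) //= eqxx rmorph1 mul1r big1 ?addr0 // => j /negPf ->.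
    by rewrite rmorph0 mul0r.
  - exact: ffD.
move=> s sP one; apply: M1; rewrite one big_seq; apply: (big_ind M).
- exact: module0 mM.
- by move=> ? ?; exact: (moduleD mM).
move=> q /sP [J'q Cq]; rewrite mulrC; apply: (moduleM mM); last exact: J'M.
apply: (colonD) => y J'y; apply: (colonD) => z J'z.
by apply: (maximal_sub maxM); apply: J'M; exact: Cq.
Qed.

Lemma span2_fin_gen (p q : K) : fin_gen (span2 p q).
Proof.
exists 2, (fun i => if i == ord0 then p else q); apply/seteqP; split=> x.
  move=> [a [b ->]]; exists (fun i => if i == ord0 then a else b).
  by rewrite !big_ord_recl big_ord0 /= addr0.
by move=> [c ->]; rewrite !big_ord_recl big_ord0 /= addr0; eexists _, _.
Qed.

Lemma sub_t_closure (I : set K) : is_submodule I -> nonzero I -> I `<=` t_closure I.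
Proof.
move=> sI [y Iy y_neq0] x Ix; have mI := submodule_over_dom sI.
exists (span2 x y); split.
- exact: span2_submodule.
- by exists y => //; exact: span2r.
- exact: span2_fin_gen.
- by move=> _ [a [b ->]]; apply: (moduleD mI); apply: (moduleM mI) => //;
    exact: dom_tofrac.
- by move=> b Cb; rewrite mulrC; apply: Cb; exact: span2l.
Qed.

Definition principal (d : D) : set K := range (fun a : D => (a * d)%:F).

Lemma principal_t_ideal (d : D) : d != 0 -> t_ideal (principal d).
Proof.
move=> d_neq0; have dF_neq0 : d%:F != 0 by rewrite tofrac_eq0.
set P := principal d.
have PE x : P x <-> dom (x / d%:F).
  split=> [[a _ <-]|[a _ aE]]; first by exists a => //; rewrite rmorphM mulfK.
  by exists a => //; rewrite rmorphM /= aE divfK.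
have sP : is_submodule P.
  split; first by exists 0; rewrite ?mul0r ?rmorph0.
    by move=> _ _ [a _ <-] [b _ <-]; exists (a + b) => //; rewrite -rmorphD mulrDl.
  by move=> c _ [a _ <-]; exists (c * a) => //; rewrite -rmorphM mulrA.
have P_neq0 : nonzero P by exists d%:F => //; exists 1 => //; rewrite mul1r.
split => //.
  split => //; exists 1; first exact: oner_neq0.
  by move=> _ [a _ <-]; rewrite rmorph1 mul1r; exact: dom_tofrac.
apply/seteqP; split; first exact: sub_t_closure.
by move=> x [J [_ _ _ JP Jvx]]; apply/PE/Jvx => y /JP /PE; rewrite mulrC.
Qed.

Lemma maximal_t_maximal M (d : D) : d != 0 -> maximal_in dom M -> M d%:F -> t_maximal M.
Proof.
move=> d_neq0 maxM Md; have mM := maximal_module maxM.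
have sM : is_submodule M.
  split; [exact: module0 mM | by move=> ? ?; exact: (moduleD mM) |].
  by move=> a x Mx; apply: (moduleM mM) => //; exact: dom_tofrac.
have MD : M `<=` dom by move=> x; exact: maximal_sub maxM x.
have [_ M1 Mmax] := maxM.
have M_neq0 : nonzero M by exists d%:F; rewrite ?tofrac_eq0.
split; first split; first split => //.
- split => //; exists 1; first exact: oner_neq0.
  by move=> x /MD; rewrite rmorph1 mul1r.
- by apply/seteqP; split; [exact: sub_t_closure | move=> x; exact: maximal_t_closed].
- by split => // /(_ 1 (subring1 rD)).
move=> J [[[sJ _] _ _] [JD DJ]] MJ; apply/seteqP; split=> // x Jx.
have mJ := submodule_over_dom sJ.
apply: contrapT => Mx; have [b Db Mb] := Mmax x (JD x Jx) Mx.
apply: DJ => y Dy; rewrite -[y]mulr1 -(subrK (b * x) 1).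
apply: (moduleM mJ) => //; apply: (moduleD mJ); first exact: MJ.
exact: (moduleM mJ).
Qed.

Lemma finite_character (d : D) : t_finite_character D -> d != 0 ->
  finite_set [set M | maximal_in dom M /\ M d%:F].
Proof.
move=> tfc d_neq0.
have [[M0 [maxM0 M0d]]|noM] :=
  pselect (exists M, maximal_in dom M /\ M d%:F); last first.
  by rewrite (_ : [set M | _] = set0) // -subset0 => M MP; apply: noM; exists M.
have proper : proper_t_ideal (principal d).
  split; first exact: principal_t_ideal.
  split; first by move=> _ [a _ <-]; exact: dom_tofrac.
  move=> /(_ 1 (subring1 rD)) [a _ ad]; have [_ M01 _] := maxM0; apply: M01.
  rewrite -ad rmorphM; apply: (moduleM (maximal_module maxM0)) => //; exact: dom_tofrac.
apply: sub_finite_set (tfc _ proper) => M [maxM Md]; split.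
  exact: maximal_t_maximal Md.
move=> _ [a _ <-]; rewrite rmorphM.
by apply: (moduleM (maximal_module maxM)) => //; exact: dom_tofrac.
Qed.

(** One local generator for each of the at most two maximal ideals above M. *)
Lemma generators_above (I : fracIdeal D) M : nonzero I -> maximal_in dom M ->
  exists xs : seq K, (forall x, x \in xs -> ideal_set I x) /\
    forall N, maximal_in (colon I I) N -> N `&` dom `<=` M ->
      exists2 x, x \in xs & local_generator I N x.
Proof.
move=> I_neq0 maxM.
pose above N := maximal_in (colon I I) N /\ N `&` dom `<=` M.
have [Ns [NsA NsP]] : exists Ns : seq (set K),
    (forall N, N \in Ns -> above N) /\ (forall N, above N -> N \in Ns).
  have [[N1 a1]|no1] := pselect (exists N, above N); last first.
    by exists [::]; split => // N aN; case: no1; exists N.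
  have [[N2 [a2 n12]]|no2] := pselect (exists N, above N /\ N <> N1); last first.
    exists [:: N1]; split => N; first by rewrite inE => /eqP ->.
    by move=> aN; rewrite inE; apply/eqP; apply: contrapT => nN; apply: no2; exists N.
  exists [:: N1; N2]; split => N; first by rewrite !inE => /orP[] /eqP ->.
  move=> aN; rewrite -[_ \in _]negbK; apply/negP => nN.
  apply: (at_most_two_above I_neq0 maxM (N1 := N) (N2 := N1) (N3 := N2)).
    by move=> N'; rewrite !inE => /or3P[] /eqP ->.
  by rewrite cons_uniq nN /= inE andbT; apply/eqP/nesym.
have /choice [f fP] : forall N, exists x, above N -> local_generator I N x.
  move=> N; have [aN|] := pselect (above N); last by exists 0.
  by have [x xP] := faithfully_flat_local_generator (ffD I_neq0) aN.1; exists x.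
exists [seq f N | N <- Ns]; split.
  by move=> _ /mapP[N /NsA aN ->]; have [] := fP N aN.
move=> N maxN NM; exists (f N); last exact: fP.
by apply: map_f; apply: NsP.
Qed.

(** For y in I, the elements t of E such that t y is generated by xs form an ideal.
It contains e, and for a maximal ideal N containing e it contains a denominator
outside N, so it is all of E. *)
Lemma faithfully_flat_invertible (I : fracIdeal D) :
  t_finite_character D -> nonzero I -> trace_ideal I 1.
Proof.
move=> tfc I_neq0; have [x0 Ix0 x0_neq0] := I_neq0.
have rE := endo_subring I.
have [d d_neq0 dI] := conductor I.
have [e _ eE] := dI x0 Ix0.
have e_neq0 : e != 0 by rewrite -tofrac_eq0 eE mulf_neq0 // tofrac_eq0.
have /finite_seqP [Ms MsP] := finite_character tfc e_neq0.
have MsE M : M \in Ms <-> maximal_in dom M /\ M e%:F.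
  by rewrite -[maximal_in _ _ /\ _]/([set M | maximal_in dom M /\ M e%:F] M) MsP.
have /choice [g gP] : forall M, exists xs : seq K, maximal_in dom M ->
    (forall x, x \in xs -> ideal_set I x) /\
    forall N, maximal_in (colon I I) N -> N `&` dom `<=` M ->
      exists2 x, x \in xs & local_generator I N x.
  move=> M; have [maxM|] := pselect (maximal_in dom M); last by exists [::].
  by have [xs xsP] := generators_above I_neq0 maxM; exists xs.
pose xs := x0 :: flatten [seq g M | M <- Ms].
have xsI x : x \in xs -> ideal_set I x.
  rewrite inE => /orP[/eqP -> //|/flattenP [_ /mapP [M /MsE [maxM _] ->]]].
  exact: (gP M maxM).1.
apply: (@fin_gen_invertible _ I xs) => //; last exact: ffD.
move=> S mS Sxs y Iy.
pose A := [set t | colon I I t /\ S (t * y)].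
suff [_] : A 1 by rewrite mul1r.
apply: (ideal_eq_ring rE).
  split; last by move=> t [].
  split; first by split; [exact: subring0 rE | rewrite mul0r; exact: module0 mS].
    move=> t u [Et St] [Eu Su]; split; first exact: (subringD rE).
    by rewrite mulrDl; exact: (moduleD mS).
  move=> b t Eb [Et St]; split; first exact: (subringM rE).
  by rewrite -mulrA; exact: (moduleM mS).
move=> N maxN; have mN := maximal_module maxN.
have [Ne|Ne] := pselect (N e%:F); last first.
  exists e%:F => //; split; first exact/dom_sub_endo/dom_tofrac.
  rewrite eE mulrAC; apply: (moduleM mS); first exact/dom_sub_endo/dI.
  by apply: Sxs; rewrite inE eqxx.
have iN : ideal_of dom (N `&` dom).
  split; last by move=> x [].
  split; first by split; [exact: module0 mN | exact: subring0 rD].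
    by move=> u v [Nu Du] [Nv Dv]; split; [exact: (moduleD mN) | exact: (subringD rD)].
  move=> b u Db [Nu Du]; split; last exact: (subringM rD).
  by apply: (moduleM mN) => //; exact: dom_sub_endo.
have [M maxM NM] : exists2 M, maximal_in dom M & N `&` dom `<=` M.
  by apply: (exists_maximal rD iN) => -[]; case: maxN.
have MMs : M \in Ms.
  by apply/MsE; split => //; apply: NM; split => //; exact: dom_tofrac.
have [x xg [Ix xP]] := (gP M maxM).2 N maxN NM.
have [t [Et Nt [c Ec tc]]] := xP y Iy.
exists t => //; split => //; rewrite tc; apply: (moduleM mS) => //.
apply: Sxs; rewrite inE; apply/orP; right; apply/flattenP; exists (g M) => //.
exact: map_f.
Qed.
End FaithfullyFlatDomain.

Theorem proposition2p1 (D : idomainType) :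
  t_finite_character D ->
  (stable_domain D <->
   forall I : fracIdeal D, nonzero I -> faithfully_flat_in_endo I).
Proof.
move=> tfc; split=> [stD|ffD] I I_neq0.
  have inv := projective_invertible I_neq0 (stD I I_neq0).
  by case: (invertible_projective_faithfully_flat inv).
have inv := faithfully_flat_invertible ffD tfc I_neq0.
by case: (invertible_projective_faithfully_flat inv).
Qed.
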